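(* For every fixed $t\in\mathbb{N}$ there is a constant $C_t$ (depending only on $t$) and a 1-sided error, nonadaptive, $t$-online-erasure-resilient $\varepsilon$-tester for quadraticity of functions $f:\{0,1\}^d\to\{0,1\}$ (for all $\varepsilon\in(0,1)$ and all $d$ sufficiently large in terms of $t$ and $\varepsilon$) that makes at most $C_t/\varepsilon$ queries, i.e., $O(1/\varepsilon)$ queries for constant $t$.
   Context: Online-erasure model. An input is a function $f:D\to R$ on a finite domain $D$. An algorithm accesses $f$ only through an oracle $\mathcal{O}$ by querying points $x\in D$ one at a time and receiving $\mathcal{O}(x)$. Initially $\mathcal{O}(x)=f(x)$ for all $x\in D$. For $t\in\mathbb{N}$, a $t$-online-erasure oracle, after answering each query, may choose up to $t$ points $x\in D$ and set $\mathcal{O}(x)=\perp$ (a special ''erased'' symbol); these values are used to answer all future queries. The choice of erasures (the adversarial strategy) may depend on $f$, on the queries and answers so far, and on the algorithm's code, but not on the algorithm's future random coins; the algorithm does not know where erasures are. A property $\mathcal{P}$ is a set of functions; $f$ is $\varepsilon$-far from $\mathcal{P}$ if for every $g\in\mathcal{P}$, $f$ and $g$ differ on at least an $\varepsilon$ fraction of $D$. A $t$-online-erasure-resilient $\varepsilon$-tester for $\mathcal{P}$ is a randomized algorithm that, given $t,\varepsilon$ and access to $f$ via a $t$-online-erasure oracle, for every adversarial strategy accepts with probability at least $2/3$ if $f\in\mathcal{P}$ and rejects with probability at least $2/3$ if $f$ is $\varepsilon$-far from $\mathcal{P}$. It has 1-sided error if it accepts every $f\in\mathcal{P}$ with probability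 1; it is nonadaptive if its queries do not depend on answers to previous queries. A function $f:\{0,1\}^d\to\{0,1\}$ is quadratic if it can be written (over $\mathbb{F}_2$) as a sum of monomials of the form $x[i]$ or $x[i]x[j]$, $i,j\in[d]$. *)

(* Defs.v *)
From HB Require Import structures.
From mathcomp Require Import all_boot all_order all_algebra.
From mathcomp Require Import reals.
Set Implicit Arguments. Unset Strict Implicit. Unset Printing Implicit Defensive.
Import Order.TTheory GRing.Theory Num.Theory.
Local Open Scope ring_scope.

Definition cube (d : nat) := {ffun 'I_d -> bool}.

Definition quadratic (d : nat) (f : cube d -> bool) : Prop :=
  exists (a : 'I_d -> bool) (b : 'I_d -> 'I_d -> bool),
    forall x : cube d,
      f x = addb (\big[addb/false]_(i < d) (a i && x i))
                 (\big[addb/false]_(i < d) \big[addb/false]_(j < d)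
                     [&& b i j, x i & x j]).

Definition far (R : realType) (D : finType) (eps : R)
    (P : (D -> bool) -> Prop) (f : D -> bool) : Prop :=
  forall g, P g -> eps * #|D|%:R <= #|[set x | f x != g x]|%:R.

(* An (online) adversarial strategy: after each query, given the history of
   (query, answer) pairs so far (including the current one), it chooses a
   set of points to erase.  None plays the role of the erased symbol. *)
Definition adversary (D : finType) := seq (D * option bool) -> {set D}.

Definition t_adversary (D : finType) (t : nat) (adv : adversary D) : Prop :=
  forall h, (#|adv h| <= t)%N.

Fixpoint run_aux (D : finType) (f : D -> bool) (adv : adversary D)
    (E : {set D}) (hist : seq (D * option bool)) (qs : seq D)
    : seq (option bool) :=
  match qs with
  | [::] => [::]
  | x :: qs' =>
      let a := if x \in E then None else Some (f x) in
      let h' := rcons hist (x, a) in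
      a :: run_aux f adv (E :|: adv h') h' qs'
  end.

Definition run (D : finType) (f : D -> bool) (adv : adversary D) (qs : seq D) :=
  run_aux f adv set0 [::] qs.

Definition prob (R : realType) (Omega : finType) (A : pred Omega) : R :=
  #|[set r | A r]|%:R / #|Omega|%:R.

(* A nonadaptive randomized algorithm is given by a finite coin space Omega,
   a query sequence qs r fixed by the coins r (nonadaptivity), and a decision
   dec r answers.  It is a 1-sided error t-online-erasure-resilient
   eps-tester for P if, for every t-adversary, it accepts every f in P with
   probability 1 and rejects every f eps-far from P with probability >= 2/3. *)
Definition oe_tester_1sided (R : realType) (D : finType) (t : nat) (eps : R)
    (P : (D -> bool) -> Prop) (Omega : finType) (qs : Omega -> seq D)
    (dec : Omega -> seq (option bool) -> bool) : Prop :=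
  (forall f, P f -> forall adv, t_adversary t adv ->
     prob R (fun r => dec r (run f adv (qs r))) = 1)
  /\
  (forall f, far eps P f -> forall adv, t_adversary t adv ->
     2 / 3 <= prob R (fun r => ~~ dec r (run f adv (qs r)))).

(* Main.v *)
Require Import Defs.
From Stdlib Require Import Btauto.
From HB Require Import structures.
From mathcomp Require Import all_boot all_order all_algebra.
From mathcomp Require Import reals zify lra ring.
Set Implicit Arguments. Unset Strict Implicit. Unset Printing Implicit Defensive.
Import Order.TTheory GRing.Theory Num.Theory.
Local Open Scope ring_scope.

(** A function is quadratic iff its values at the seven nonzero combinations of
    any three points sum to zero.  The tester repeats [O(1/eps)] times a gadget
    whose size depends on [t] only: draw random points [p], [y_i], [z_j] and
    query a random sequence of their subset sums.

    The erasures form a game.  As long as a point is not queried, the sums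
    involving it look uniformly random to the adversary, who can only erase them
    by accident.  So after querying all [y_i] one can query [z_1, z_2, ...] in
    turn, each followed by sums [z_j + y_i] for [i] in a shrinking set of
    survivors; then [p], several [p + z_j] and [p + y_i]; and there remain more
    candidates [p + y_i + z_j] than the adversary had time to erase since [p]
    appeared.  A winning sequence of subset sums always exists, and guessing it
    succeeds with constant probability.

    It remains that, with probability of order [eps], every triple
    [(p, y_i, z_j)] of the gadget is violating.  If a constant fraction of all
    triples is violating, this follows from the power mean inequality.
    Otherwise self-correction shows that [f] differs from a quadratic function
    only on a set [S] of small density, at least [eps] by assumption, and it is
    enough that [p] lies in [S] and no other subset sum does. *)

(** * Self-correction *)

Definition violation (D : finZmodType) (f : D -> bool) (x y z : D) : bool :=
  f x (+) f y (+) f z (+) f (x + y) (+) f (x + z) (+) f (y + z)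
  (+) f (x + y + z).

Definition violations (D : finZmodType) (f : D -> bool) : nat :=
  \sum_x \sum_y \sum_z violation f x y z.

Lemma addb_xorb (b c : bool) : b (+) c = xorb b c.
Proof. by case: b; case: c. Qed.

Ltac generalize_values g :=
  repeat match goal with |- context [g ?x] =>
    let b := fresh "b" in generalize (g x) => b end.

Ltac xor_taut g :=
  rewrite ?addb_xorb; generalize_values g; btauto.

Lemma addb_leq (b c : bool) : (b (+) c <= b + c)%N.
Proof. by case: b; case: c. Qed.

Section SelfCorrection.
Local Open Scope nat_scope.
Variables (D : finZmodType) (f : D -> bool).
Hypothesis char2 : forall x : D, (x + x = 0)%R.

Let N := #|D|.
Let V := violation f.
Let B := violations f.

(** The value [f] would have at [a] if the triple [a], [y], [z] were not violating. *)
Definition vote (a y z : D) : bool :=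
  f y (+) f z (+) f (a + y)%R (+) f (a + z)%R (+) f (y + z)%R
  (+) f (a + y + z)%R.

Definition majority (a : D) : bool := N ^ 2 < 2 * \sum_y \sum_z vote a y z.

Definition dissent (a y z : D) : bool := vote a y z (+) majority a.

Lemma vote_violation a y z : V a y z = vote a y z (+) f a.
Proof. by rewrite /V /violation /vote; xor_taut f. Qed.

Lemma voteC a y z : vote a y z = vote a z y.
Proof.
rewrite /vote.
have -> : (z + y = y + z)%R by exact: addrC.
have -> : (a + z + y = a + y + z)%R by exact: addrAC.
xor_taut f.
Qed.

(** In characteristic 2 the two violations share the values at [y], [z + z'] and [y + z + z'], which
    cancel. The other eight are those left of the two votes once [f y] and [f (a + y)] cancel. *)
Lemma vote_vote a y z z' :
  vote a y z (+) vote a y z' = V y z z' (+) V y (a + z)%R (a + z')%R.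
Proof.
rewrite /vote /V /violation.
have -> : (a + z + (a + z') = z + z')%R by rewrite addrACA char2 add0r.
have -> : (y + (a + z) + (a + z') = y + z + z')%R.
  by rewrite -addrA addrACA char2 add0r addrA.
have -> : (y + (a + z) = a + y + z)%R by rewrite addrCA addrA.
have -> : (y + (a + z') = a + y + z')%R by rewrite addrCA addrA.
xor_taut f.
Qed.

Lemma sum_shift (F : D -> nat) (a : D) : \sum_x F (a + x)%R = \sum_x F x.
Proof. by rewrite [RHS](reindex_inj (addrI a)). Qed.

Lemma vote_vote_sum a :
  \sum_y \sum_z \sum_z' (vote a y z (+) vote a y z') <= 2 * B.
Proof.
apply: (@leq_trans (\sum_y \sum_z \sum_z' (V y z z' + V y (a + z)%R (a + z')%R))).
  do 3![apply: leq_sum => ? _]; rewrite vote_vote; exact: addb_leq.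
rewrite mul2n -addnn /B /violations -big_split leq_sum //= => y _.
under eq_bigr do rewrite big_split /= (sum_shift (fun z' => V y (a + _)%R z')).
by rewrite big_split /= (sum_shift (fun z => \sum_z' V y z z')).
Qed.

(** Pass from [(y, z)] to [(y', z')] through [(y, z')]. By symmetry of [vote] each move falls under
    the previous bound, with one idle variable contributing a factor [N]. *)
Lemma vote_pairs_sum a :
  \sum_y \sum_z \sum_y' \sum_z' (vote a y z (+) vote a y' z') <= 4 * N * B.
Proof.
apply: (@leq_trans (\sum_y \sum_z \sum_y' \sum_z'
    ((vote a y z (+) vote a y z') + (vote a z' y (+) vote a z' y')))).
  apply: leq_sum => y _; apply: leq_sum => z _.
  apply: leq_sum => y' _; apply: leq_sum => z' _.
  rewrite (voteC a z' y) (voteC a z' y').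
  by case: (vote _ _ _); case: (vote _ _ _); case: (vote _ _ _).
have -> : 4 * N * B = N * (2 * B) + N * (2 * B) by lia.
under eq_bigr do under eq_bigr do under eq_bigr do rewrite big_split.
under eq_bigr do under eq_bigr do rewrite big_split.
under eq_bigr do rewrite big_split.
rewrite big_split /=; apply: leq_add.
  under eq_bigr do under eq_bigr do rewrite sum_nat_const.
  under eq_bigr do rewrite -big_distrr /=.
  by rewrite -big_distrr /= leq_mul2l vote_vote_sum orbT.
rewrite exchange_big sum_nat_const leq_mul2l; apply/orP; right.
apply: leq_trans (vote_vote_sum a).
under eq_bigr do rewrite exchange_big /=.
by rewrite exchange_big.
Qed.

Let votes a := \sum_y \sum_z vote a y z.

Lemma card_sqr : N ^ 2 = \sum_(y : D) \sum_(z : D) 1.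
Proof. by rewrite !sum_nat_const muln1 mulnn. Qed.

Lemma votes_compl a : \sum_y \sum_z ~~ vote a y z = N ^ 2 - votes a.
Proof.
suff -> : N ^ 2 = \sum_y \sum_z ~~ vote a y z + votes a by rewrite addnK.
rewrite -big_split card_sqr; apply: eq_bigr => y _; rewrite -big_split.
by apply: eq_bigr => z _; case: vote.
Qed.

Lemma votes_le a : votes a <= N ^ 2.
Proof.
rewrite card_sqr; apply: leq_sum => y _; apply: leq_sum => z _; exact: leq_b1.
Qed.

Lemma sum_dissent a :
  \sum_y \sum_z dissent a y z = if majority a then N ^ 2 - votes a else votes a.
Proof.
rewrite -votes_compl; case: ifP => m.
all: by apply: eq_bigr => y _; apply: eq_bigr => z _; rewrite /dissent m ?addbT ?addbF.
Qed.

Lemma vote_pairs_sumE a :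
  \sum_y \sum_z \sum_y' \sum_z' (vote a y z (+) vote a y' z')
  = 2 * votes a * (N ^ 2 - votes a).
Proof.
have E y z : \sum_y' \sum_z' (vote a y z (+) vote a y' z')
    = vote a y z * (N ^ 2 - votes a) + (~~ vote a y z) * votes a.
  case: (vote a y z); rewrite ?mul1n ?mul0n ?addn0 ?add0n.
    by rewrite -votes_compl; apply: eq_bigr => y' _; apply: eq_bigr.
  by apply: eq_bigr => y' _; apply: eq_bigr.
under eq_bigr do under eq_bigr do rewrite E.
under eq_bigr do rewrite big_split /= -!big_distrl.
rewrite big_split /= -!big_distrl /= votes_compl -/(votes a).
have := votes_le a; nia.
Qed.

(** The larger camp holds at least half of the [N ^ 2] votes, so there are at least [N ^ 2]
    disagreeing pairs per member of the smaller camp, which is what [dissent] counts. *)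
Lemma sum_dissent_le a : N * \sum_y \sum_z dissent a y z <= 4 * B.
Proof.
have := vote_pairs_sum a; rewrite vote_pairs_sumE sum_dissent => h.
have N0 : 0 < N by apply/card_gt0P; exists 0%R.
rewrite -(leq_pmul2l N0); apply: (leq_trans _ (leq_trans h _)); last by rewrite mulnCA mulnA.
have := votes_le a; rewrite /majority -/(votes a); case: ltnP => h1 h2; nia.
Qed.

(** Where [f] differs from [majority], every pair that does not dissent completes a violating
    triple, and these pairs are at least half of all. *)
Lemma majority_dist : #|[set x | f x != majority x]| * N ^ 2 <= 2 * B.
Proof.
rewrite -sum1_card big_distrl /B /violations big_distrr /= big_mkcond /=.
apply: leq_sum => a _; rewrite inE mul1n; case: ifP => // ne.
suff: N ^ 2 <= 2 * \sum_y \sum_z V a y z by [].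
have E : \sum_y \sum_z V a y z + \sum_y \sum_z dissent a y z = N ^ 2.
  rewrite -big_split card_sqr; apply: eq_bigr => y _; rewrite -big_split.
  apply: eq_bigr => z _; rewrite vote_violation /dissent.
  by move: ne; case: f; case: majority; case: vote.
have := votes_le a; move: E; rewrite sum_dissent -/V /majority -/(votes a).
case: ltnP => h1 h2 h3; lia.
Qed.

Lemma sum_pair_shift (F : D * D -> nat) (a : D * D) :
  \sum_x F (a + x)%R = \sum_x F x.
Proof. by rewrite [RHS](reindex_inj (addrI a)). Qed.

Lemma sum_fibers (F : D -> nat) (l : D -> D -> D) :
    (forall y, injective (l y)) ->
  \sum_(p : D * D) F (l p.1 p.2) = N * \sum_x F x.
Proof.
move=> linj; rewrite -(pair_bigA_idem _ (fun y z => F (l y z))) //=.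
transitivity (\sum_(y : D) \sum_x F x); last by rewrite sum_nat_const.
by apply: eq_bigr => y _; rewrite [RHS](reindex_inj (linj y)).
Qed.

(* Choosing the voters [pa], [pb], [pc] additively, the seven votes at the
   nonzero combinations of [a], [b], [c] add up to six violations of [f] at
   uniformly random triples. *)
Lemma majority_violation a b c : 34 * B < N ^ 3 -> violation majority a b c = false.
Proof.
move=> Bsmall; apply/negbTE/negP => viol.
pose dis a (p : D * D) := dissent a p.1 p.2.
pose vio (l : D -> D -> D -> D) (pa pb pc : D * D) : bool :=
  V (l a pa.1 pa.2) (l b pb.1 pb.2) (l c pc.1 pc.2).
(* The six points at which a vote evaluates [f]. Each is additive in [(a, y, z)], so collecting it
   over the seven combinations gives one violation of [f]. *)
pose l1 (a y z : D) := y; pose l2 (a y z : D) := z.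
pose l3 (a y z : D) := (a + y)%R; pose l4 (a y z : D) := (a + z)%R.
pose l5 (a y z : D) := (y + z)%R; pose l6 (a y z : D) := (a + y + z)%R.
have key (pa pb pc : D * D) : 1 <=
   (dis a pa + dis b pb + dis c pc + dis (a + b)%R (pa + pb)%R
    + dis (a + c)%R (pa + pc)%R + dis (b + c)%R (pb + pc)%R
    + dis (a + b + c)%R (pa + pb + pc)%R)
   + (vio l1 pa pb pc + vio l2 pa pb pc + vio l3 pa pb pc
      + vio l4 pa pb pc + vio l5 pa pb pc + vio l6 pa pb pc).
  have parity : violation majority a b c =
    (dis a pa (+) dis b pb (+) dis c pc (+) dis (a + b)%R (pa + pb)%R
    (+) dis (a + c)%R (pa + pc)%R (+) dis (b + c)%R (pb + pc)%R
    (+) dis (a + b + c)%R (pa + pb + pc)%R)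
   (+) (vio l1 pa pb pc (+) vio l2 pa pb pc (+) vio l3 pa pb pc
      (+) vio l4 pa pb pc (+) vio l5 pa pb pc (+) vio l6 pa pb pc).
    case: pa pb pc => [ya za] [yb zb] [yc zc].
    rewrite /dis /vio /dissent /V /violation /vote /l1 /l2 /l3 /l4 /l5 /l6 /=.
    have A1 (x x' y y' : D) : (x + x' + (y + y') = x + y + (x' + y'))%R := addrACA x x' y y'.
    have A2 (x x' x'' y y' y'' : D) :
      (x + x' + x'' + (y + y' + y'') = x + y + (x' + y') + (x'' + y''))%R.
      by rewrite (addrACA (x + x')%R) (addrACA x).
    rewrite !(A1 a b) !(A1 a c) !(A1 b c) !(A2 a b c).
    rewrite !(A1 ya yb) !(A1 ya yc) !(A1 yb yc) !(A2 ya yb yc).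
    rewrite !(A1 (a + ya)%R (b + yb)%R za zb) !(A1 (a + ya)%R (c + yc)%R za zc).
    rewrite !(A1 (b + yb)%R (c + yc)%R zb zc) !(A2 (a + ya)%R (b + yb)%R (c + yc)%R).
    generalize_values majority; xor_taut f.
  apply: contraTT viol; rewrite -leqNgt leqn0 !addn_eq0 !eqb0 -!andbA parity.
  by do 13![case/andP || idtac => /negbTE ->].
have N0 : 0 < N by apply/card_gt0P; exists 0%R.
have cardDD : #|{: D * D}| = N ^ 2 by rewrite card_prod mulnn.
have sumdis u : N * \sum_p dis u p <= 4 * B.
  by rewrite -(pair_bigA_idem _ (fun y z => dissent u y z : nat)) //= sum_dissent_le.
(* The triple inspected by [vio l] is uniform, since [l u] is a bijection either in its last
   argument or as a function of [y] alone. *)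
have sumvio l : (forall u y, injective (l u y)) \/
    (forall u, exists2 l' : D -> D, injective l' & forall y z, l u y z = l' y) ->
  \sum_pa \sum_pb \sum_pc vio l pa pb pc = N ^ 3 * B.
  move=> lP.
  have fib (F : D -> nat) u : \sum_(p : D * D) F (l u p.1 p.2) = N * \sum_x F x.
    case: lP => [h | /(_ u) [l' li le]]; first exact: sum_fibers.
    rewrite -(pair_bigA_idem _ (fun y z => F (l u y z))) //=.
    under eq_bigr => y _ do under eq_bigr do rewrite le.
    under eq_bigr do rewrite sum_nat_const.
    by rewrite -big_distrr /= [in RHS](reindex_inj li).
  rewrite /vio.
  under eq_bigr => pa _ do under eq_bigr => pb _ do
    rewrite (fib (fun z => V (l a pa.1 pa.2) (l b pb.1 pb.2) z : nat)).
  under eq_bigr => pa _ do rewrite -big_distrr /=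
    (fib (fun y => \sum_z (V (l a pa.1 pa.2) y z : nat))).
  rewrite -!big_distrr /= (fib (fun x => \sum_y \sum_z (V x y z : nat))).
  by rewrite /B /violations -/V; lia.
(* Sum [key] over all voters: up to the factor [N ^ 3], seven dissents cost at most [4 * B] each and
   six violations [B] each, which makes 34. *)
have tot : N ^ 6 <= N ^ 3 * (34 * B).
  have -> : N ^ 6 = \sum_(pa : D * D) \sum_(pb : D * D) \sum_(pc : D * D) 1.
    by rewrite !sum_nat_const cardDD; lia.
  apply: leq_trans.
    apply: leq_sum => pa _; apply: leq_sum => pb _; apply: leq_sum => pc _.
    exact: (key pa pb pc).
  do 12!under eq_bigr do under eq_bigr do rewrite big_split /=.
  do 12!under eq_bigr do rewrite big_split /=.
  rewrite !big_split /= !sumvio; first last.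
  all: try by left=> u y z z' /addrI.
  all: try by left=> u y z z' /=.
  all: try by right=> u; exists id.
  all: try by right=> u; exists (fun y => u + y)%R => //; apply: addrI.
  pose E u := N ^ 2 * (N ^ 2 * \sum_p dis u p).
  have cst n : \sum_(p : D * D) n = N ^ 2 * n by rewrite sum_nat_const cardDD.
  have shift u (p : D * D) : \sum_(q : D * D) dis u (p + q)%R = \sum_q dis u q.
    exact: (sum_pair_shift (fun q => dis u q : nat)).
  have -> : \sum_(pa : D * D) \sum_(pb : D * D) \sum_(pc : D * D) dis a pa = E a.
    by under eq_bigr do rewrite !cst; rewrite -!big_distrr.
  have -> : \sum_(pa : D * D) \sum_(pb : D * D) \sum_(pc : D * D) dis b pb = E b.
    by rewrite cst; under eq_bigr do rewrite cst; rewrite -!big_distrr.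
  have -> : \sum_(pa : D * D) \sum_(pb : D * D) \sum_(pc : D * D) dis c pc = E c.
    by rewrite !cst.
  have -> : \sum_(pa : D * D) \sum_(pb : D * D) \sum_(pc : D * D)
      dis (a + b)%R (pa + pb)%R = E (a + b)%R.
    under eq_bigr do under eq_bigr do rewrite cst.
    by under eq_bigr do rewrite -big_distrr /= shift; rewrite cst.
  have -> : \sum_(pa : D * D) \sum_(pb : D * D) \sum_(pc : D * D)
      dis (a + c)%R (pa + pc)%R = E (a + c)%R.
    by under eq_bigr do under eq_bigr do rewrite shift; rewrite !cst.
  have -> : \sum_(pa : D * D) \sum_(pb : D * D) \sum_(pc : D * D)
      dis (b + c)%R (pb + pc)%R = E (b + c)%R.
    by under eq_bigr do under eq_bigr do rewrite shift; rewrite !cst.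
  have -> : \sum_(pa : D * D) \sum_(pb : D * D) \sum_(pc : D * D)
      dis (a + b + c)%R (pa + pb + pc)%R = E (a + b + c)%R.
    by under eq_bigr do under eq_bigr do rewrite shift; rewrite !cst.
  have Ele u : E u <= N ^ 3 * (4 * B).
    have -> : E u = N ^ 3 * (N * \sum_p dis u p) by rewrite /E; lia.
    by rewrite leq_mul2l sumdis orbT.
  move: (Ele a) (Ele b) (Ele c) (Ele (a + b)%R) (Ele (a + c)%R).
  move: (Ele (b + c)%R) (Ele (a + b + c)%R).
  clearbody E; rewrite !(mulnCA (N ^ 3)); move: (N ^ 3 * B) => n; lia.
move: tot; rewrite (_ : N ^ 6 = N ^ 3 * N ^ 3); last by rewrite -expnD.
by rewrite leq_pmul2l ?expn_gt0 ?N0 // leqNgt Bsmall.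
Qed.

End SelfCorrection.

(** * Quadratic functions *)

Lemma violation_add (D : finZmodType) (f g : D -> bool) x y z :
  violation (fun u => f u (+) g u) x y z = violation f x y z (+) violation g x y z.
Proof. rewrite /violation; generalize_values f; xor_taut g. Qed.

Lemma eq_violation (D : finZmodType) (f g : D -> bool) x y z :
  f =1 g -> violation f x y z = violation g x y z.
Proof. by move=> fg; rewrite /violation !fg. Qed.

(** The polarization of [f]; violations measure its failure to be additive in [y]. *)
Definition polar (D : finZmodType) (f : D -> bool) (x y : D) : bool :=
  f x (+) f y (+) f (x + y).

Lemma polar_violation (D : finZmodType) (f : D -> bool) x y z :
  polar f x y (+) polar f x z (+) polar f x (y + z) = violation f x y z.
Proof.
rewrite /polar /violation; have -> : x + (y + z) = x + y + z by exact: addrA.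
xor_taut f.
Qed.

HB.instance Definition _ (d : nat) := GRing.Zmodule.on (cube d).
HB.instance Definition _ (d : nat) := Finite.on (cube d).

Section QuadraticForms.
Variable d : nat.
Implicit Types (x y z : cube d) (f g : cube d -> bool).

Lemma cubeD x y i : (x + y) i = x i (+) y i.
Proof. by rewrite ffunE. Qed.

Lemma cube0 i : (0 : cube d) i = false.
Proof. by rewrite ffunE. Qed.

Lemma cube_char2 x : x + x = 0.
Proof. by apply/ffunP => i; rewrite cubeD cube0 addbb. Qed.

Lemma violation_sum (I : finType) (F : I -> cube d -> bool) x y z :
  violation (fun u => \big[addb/false]_i F i u) x y z
  = \big[addb/false]_i violation (F i) x y z.
Proof. by rewrite /violation -!big_split. Qed.

Lemma quadratic_violation f x y z : quadratic f -> violation f x y z = false.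
Proof.
move=> [a [b fE]]; rewrite (eq_violation _ _ _ fE) violation_add.
rewrite !violation_sum !big1 // => i _.
  rewrite violation_sum big1 // => j _; rewrite /violation !cubeD.
  case: (b i j) => //=.
  by case: (x i); case: (y i); case: (z i); case: (x j); case: (y j); case: (z j).
rewrite /violation !cubeD; case: (a i) => //=.
by case: (x i); case: (y i); case: (z i).
Qed.

Definition delta (i : 'I_d) : cube d := [ffun k => k == i].

Lemma additive_eq0 f : (forall x y, f (x + y) = f x (+) f y) ->
  (forall i, f (delta i) = false) -> forall x, f x = false.
Proof.
move=> fD f0 x.
have fz : f 0 = false by have := fD 0 0; rewrite addr0 addbb.
have -> : x = \sum_(i | x i) delta i.
  apply/ffunP => j; rewrite sum_ffunE.
  under eq_bigr do rewrite ffunE.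
  have [xj|/negbTE xj] := boolP (x j).
    rewrite (bigD1 j) //= eqxx big1 // => i /andP[_ /negbTE].
    by rewrite eq_sym.
  rewrite big1 // => i xi; apply/negbTE/eqP => ji.
  by rewrite -ji xj in xi.
by rewrite (big_morph f fD fz) big1.
Qed.

(** Subtract the form [l + q] that agrees with [f] on basis vectors and in polarization on pairs of
    distinct ones. The difference [h] has a bilinear polarization that vanishes on the basis, so [h]
    is additive, and it vanishes on the basis too. *)
Lemma violation_quadratic f :
  (forall x y z, violation f x y z = false) -> quadratic f.
Proof.
move=> nov.
pose a i := f (delta i).
(* The order keeps only one of [b i j] and [b j i]; both together would cancel. *)
pose b (i j : 'I_d) := (i < j)%N && polar f (delta i) (delta j).
pose l x := \big[addb/false]_(i < d) (a i && x i).
pose q x := \big[addb/false]_(i < d) \big[addb/false]_(j < d) [&& b i j, x i & x j].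
have lD x y : l (x + y) = l x (+) l y.
  by rewrite -big_split; apply: eq_bigr => i _; rewrite cubeD andb_addr.
have l0 : l 0 = false by rewrite /l big1 // => i _; rewrite cube0 andbF.
have q0 : q 0 = false.
  by rewrite /q big1 // => i _; rewrite big1 // => j _; rewrite cube0 !andbF.
have ldelta i : l (delta i) = a i.
  rewrite /l (bigD1 i) //= ffunE eqxx andbT big1 ?addbF // => k /negbTE ki.
  by rewrite ffunE ki andbF.
have sumdelta (F : 'I_d -> bool) i : \big[addb/false]_k (F k && delta i k) = F i.
  rewrite (bigD1 i) //= ffunE eqxx andbT big1 ?addbF // => k /negbTE ki.
  by rewrite ffunE ki andbF.
have qdelta i : q (delta i) = false.
  rewrite /q big1 // => k _; rewrite big1 // => m _; rewrite !ffunE.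
  case: eqP => [->|_]; rewrite ?andbF //.
  by case: eqP => [->|_]; rewrite /b ?ltnn ?andbF.
have qpolar i j : i != j -> polar q (delta i) (delta j) = polar f (delta i) (delta j).
  move=> ij.
  have bsum i' j' : \big[addb/false]_k \big[addb/false]_m
      [&& b k m, delta i' k & delta j' m] = b i' j'.
    rewrite -[RHS](sumdelta (fun k => b k j') i'); apply: eq_bigr => k _.
    rewrite -[RHS](sumdelta (fun m => b k m && delta i' k) j').
    by apply: eq_bigr => m _; rewrite andbA.
  transitivity (b i j (+) b j i).
    rewrite -!bsum -big_split /polar /q -!big_split; apply: eq_bigr => k _ /=.
    rewrite -!big_split; apply: eq_bigr => m _ /=; rewrite !cubeD.
    by case: (b k m); case: (delta i k);
       case: (delta j k); case: (delta i m); case: (delta j m).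
  rewrite /b; have [//|//|/ord_inj ijE] := ltngtP i j; last by rewrite ijE eqxx in ij.
    by rewrite addbF.
  by rewrite addFb /polar (addbC (f (delta j))) (addrC (delta j)).
pose h x := f x (+) (l x (+) q x).
have novh x y z : violation h x y z = false.
  rewrite violation_add nov quadratic_violation //; by exists a, b.
(* [violation h 0 0 0] is a sum of seven copies of [h 0], hence [h 0] itself. *)
have h0 : h 0 = false.
  have := novh 0 0 0; rewrite /violation !addr0.
  by case: (h 0).
have polarC x y : polar h x y = polar h y x.
  by rewrite /polar (addrC x y) (addbC (h x)).
have polarD x y z : polar h x (y + z) = polar h x y (+) polar h x z.
  have := novh x y z; rewrite -polar_violation.
  by case: (polar _ _ _); case: (polar _ _ _); case: (polar _ _ _).
have polar0 i j : polar h (delta i) (delta j) = false.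
  have [->|ij] := eqVneq i j.
    by rewrite /polar addbb cube_char2 h0.
  have := qpolar i j ij; rewrite /h /polar lD !qdelta !ldelta /a.
  by case: (f (_ + _)); case: (q (_ + _)); case: (f (delta i)); case: (f (delta j)).
exists a, b => x; rewrite -/(l x) -/(q x).
suff: h x = false by rewrite /h; case: (f x); case: (l x); case: (q x).
apply: additive_eq0 => [{}x y|i].
  have: polar h x y = false.
    apply: (additive_eq0 (polarD x)) => i; rewrite polarC.
    exact: (additive_eq0 (polarD (delta i))).
  by rewrite /polar; case: (h x); case: (h y); case: (h (x + y)).
by rewrite /h ldelta qdelta /a addbF addbb.
Qed.

End QuadraticForms.

Lemma violations_close (d : nat) (f : cube d -> bool) :
    (34 * violations f < #|cube d| ^ 3)%N ->
  exists2 g, quadratic g &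
    (#|[set x | f x != g x]| * #|cube d| ^ 2 <= 2 * violations f)%N.
Proof.
move=> h; exists (majority f); last exact: majority_dist.
by apply: violation_quadratic => x y z; apply: majority_violation h => //; exact: cube_char2.
Qed.

(** * The erasure game *)

Section Game.
Local Open Scope nat_scope.
Variable t : nat.

(** Makes [grid_side ^ 2], the number of candidates for the last sum, exceed the
    [t * (1 + 2 * grid_side)] of them that may have been erased. *)
Definition grid_side := 2 * t + 2.
(** The query of [p] may cost [t] of the sums [p + z_j]; each of the [grid_side] picks then uses one
    and exposes [t] more. *)
Definition num_z := t + grid_side * t.+1.
(* How many [y_i] must survive while [k] of the [z_j] are still to be queried. *)
Fixpoint num_y_left (k : nat) : nat :=
  if k is k'.+1 then t + num_y_left k' * t.+1
  else t * grid_side.+1 + grid_side * t.+1.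
Definition num_y := num_y_left num_z.
(** All [y_i]; each [z_j] with at most [num_y] sums; then [p], two batches of [grid_side] sums, and
    one triple sum. *)
Definition game_length := num_y + num_z * num_y.+1 + (1 + 2 * grid_side + 1).

Definition vars : finType := option ('I_num_y + 'I_num_z).
Definition var_p : vars := None.
Definition var_y (i : 'I_num_y) : vars := Some (inl i).
Definition var_z (j : 'I_num_z) : vars := Some (inr j).

Implicit Types (S : {set vars}) (Q P : seq {set vars}) (v : vars).

Definition seen (Q : seq {set vars}) : {set vars} := \bigcup_(S <- Q) S.

(* [FE Q] is the set of sums erased once the sums [Q] have been queried. *)
Variable FE : seq {set vars} -> {set {set vars}}.
Hypothesis FE_step : forall Q S, #|FE (rcons Q S) :\: FE Q| <= t.
Hypothesis FE_seen : forall Q S,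
  size Q <= game_length -> S \in FE Q -> S \subset seen Q.

(** The sum is queried at some moment when it is not erased; later erasures do no harm. *)
Definition answered (Q : seq {set vars}) (S : {set vars}) : Prop :=
  exists Q1 Q2, Q = Q1 ++ S :: Q2 /\ S \notin FE Q1.

Lemma answered_cat Q Q' S : answered Q S -> answered (Q ++ Q') S.
Proof. by move=> [Q1 [Q2 [-> h]]]; exists Q1, (Q2 ++ Q'); rewrite -catA. Qed.

Lemma answered_rcons Q S : S \notin FE Q -> answered (rcons Q S) S.
Proof. by move=> h; exists Q, [::]; rewrite cats1. Qed.

Lemma seen_cat Q Q' : seen (Q ++ Q') = seen Q :|: seen Q'.
Proof. by rewrite /seen big_cat. Qed.

Lemma seen_rcons Q S : seen (rcons Q S) = seen Q :|: S.
Proof. by rewrite -cats1 seen_cat /seen big_seq1. Qed.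

Lemma fresh_notin_FE Q S v : size Q <= game_length ->
  v \in S -> v \notin seen Q -> S \notin FE Q.
Proof.
move=> sz vS vQ; apply/negP => /(FE_seen sz) /subsetP /(_ v vS).
by rewrite (negbTE vQ).
Qed.

Section Pick.
Variables (T : finType) (F : T -> {set vars}).
Hypothesis F_inj : injective F.

Lemma erased_step (A : {set T}) Q S :
  #|[set i in A | F i \in FE (rcons Q S)]| <= #|[set i in A | F i \in FE Q]| + t.
Proof.
rewrite -(cardsID [set i in A | F i \in FE Q]); apply: leq_add.
  by rewrite subset_leq_card // subsetIr.
apply: leq_trans (FE_step Q S); rewrite -(card_imset _ F_inj) subset_leq_card //.
apply/subsetP => X /imsetP[i]; rewrite !inE => /andP[nin /andP[iA iE]] ->.
by rewrite iE andbT; move: nin; rewrite iA.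
Qed.

Lemma erased_cat (A : {set T}) Q P :
  #|[set i in A | F i \in FE (Q ++ P)]| <= #|[set i in A | F i \in FE Q]| + t * size P.
Proof.
elim/last_ind: P => [|P S IH]; first by rewrite cats0 muln0 addn0.
rewrite -rcons_cat size_rcons mulnS addnCA addnC.
by apply: leq_trans (erased_step _ _ _) _; rewrite leq_add2r.
Qed.

(** After [Q] no member of the family is erased, as all contain the unseen [v]; each further query
    costs at most [t]. *)
Lemma erased_fresh (A : {set T}) Q P v : size Q <= game_length ->
    v \notin seen Q -> (forall i, v \in F i) ->
  #|[set i in A | F i \in FE (Q ++ P)]| <= t * size P.
Proof.
move=> sz vQ vF; apply: leq_trans (erased_cat A Q P) _.
rewrite (_ : [set i in A | _] = set0) ?cards0 //.
by apply/setP => i; rewrite !inE (negbTE (fresh_notin_FE sz (vF i) vQ)) andbF.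
Qed.

(** Query any member not erased and recurse without it. A round uses up that member and at most [t]
    newly erased ones, hence the price [t.+1]. *)
Lemma pick_answered k Q (A : {set T}) :
    #|[set i in A | F i \in FE Q]| + k * t.+1 <= #|A| ->
  exists P (A' : {set T}), [/\ size P = k, seen P \subset \bigcup_i F i,
    A' \subset A, #|A'| = k & forall i, i \in A' -> answered (Q ++ P) (F i)].
Proof.
elim: k Q A => [|k IH] Q A hA.
  exists [::], set0; split; rewrite ?sub0set ?cards0 //.
    by rewrite /seen big_nil sub0set.
  by move=> i; rewrite inE.
have /card_gt0P[i] : 0 < #|[set i in A | F i \notin FE Q]|.
  move: hA; rewrite -[#|A|](cardsID [set i | F i \in FE Q]).
  rewrite setIdE (_ : A :\: _ = [set i in A | F i \notin FE Q]); first by lia.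
  by apply/setP => x; rewrite !inE andbC.
rewrite inE => /andP[iA iE].
have [|P [A' [sP suP sA cA aA]]] := IH (rcons Q (F i)) (A :\ i).
  have := cardsD1 i A; rewrite iA => cA.
  have sub : [set j in A :\ i | F j \in FE (rcons Q (F i))]
      \subset [set j in A | F j \in FE (rcons Q (F i))].
    by apply/subsetP => j; rewrite !inE => /andP[/andP[_ ->]].
  have := subset_leq_card sub; have := erased_step A Q (F i); lia.
exists (F i :: P), (i |: A'); split.
- by rewrite /= sP.
- by rewrite /seen big_cons subUset suP andbT bigcup_sup.
- by rewrite subUset sub1set iA (subset_trans sA) // subD1set.
- rewrite cardsU1 cA; suff -> : i \notin A' by [].
  by apply/negP => /(subsetP sA); rewrite !inE eqxx.
- move=> j; rewrite -cat_rcons !inE => /orP[/eqP->|/aA //].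
  exact/answered_cat/answered_rcons.
Qed.

End Pick.

Lemma set2_inj (v : vars) (T : finType) (w : T -> vars) :
  injective w -> (forall i, w i != v) -> injective (fun i => [set v; w i]).
Proof.
move=> wi wv i j /setP /(_ (w i)); rewrite !inE eqxx orbT.
by rewrite (negbTE (wv i)) => /esym /eqP /wi.
Qed.

Lemma var_y_inj : injective var_y. Proof. by move=> i j []. Qed.
Lemma var_z_inj : injective var_z. Proof. by move=> i j []. Qed.

Lemma pyz_inj : injective (fun ij => [set var_p; var_y ij.1; var_z ij.2]).
Proof.
move=> [i j] [i' j'] /= E; congr pair.
  by move/setP/(_ (var_y i)): E; rewrite !inE eqxx /= !orbF => /esym /eqP[].
by move/setP/(_ (var_z j)): E; rewrite !inE eqxx orbT /= => /esym /eqP[].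
Qed.

Lemma num_y_left_mono k k' : k <= k' -> num_y_left k <= num_y_left k'.
Proof.
elim: k' => [|k' IH]; first by rewrite leqn0 => /eqP ->.
rewrite leq_eqVlt => /orP[/eqP -> //|]; rewrite ltnS => /IH h /=; nia.
Qed.

(** The invariant after [j] rounds: [p] and the later [z_k] are unseen, and [A] holds the surviving
    [y_i], whose sums with all earlier [z_k] were answered. *)
Lemma yz_stages j : j <= num_z ->
  exists Q (A : {set 'I_num_y}),
  [/\ size Q <= num_y + j * num_y.+1,
      forall v, v \in seen Q -> if v is Some (inr k) then k < j else v != var_p,
      #|A| = num_y_left (num_z - j),
      forall i, answered Q [set var_y i] &
      forall k : 'I_num_z, k < j -> answered Q [set var_z k] /\
        forall i, i \in A -> answered Q [set var_z k; var_y i]].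
Proof.
elim: j => [_|j IH lt_j].
  pose Q := [seq [set var_y i] | i <- enum 'I_num_y].
  have suppQ s v : v \in seen [seq [set var_y i] | i <- s] ->
      exists2 i, i \in s & v = var_y i.
    elim: s => [|i s IHs]; rewrite /seen ?big_nil ?inE //= big_cons !inE.
    case/orP => [/eqP ->|/IHs[i' si' ->]]; first by exists i; rewrite ?mem_head.
    by exists i'; rewrite // inE si' orbT.
  exists Q, setT; split.
  - by rewrite size_map size_enum_ord mul0n addn0.
  - by move=> v /suppQ [i _ ->].
  - by rewrite cardsT card_ord subn0.
  - move=> i; have ei : i \in enum 'I_num_y by rewrite mem_enum.
    have ue := enum_uniq 'I_num_y.
    have sz : size (enum 'I_num_y) = num_y by rewrite size_enum_ord.
    rewrite /Q; case/splitPr: ei ue sz => s1 s2 ue sz.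
    exists [seq [set var_y i] | i <- s1], [seq [set var_y i] | i <- s2].
    rewrite map_cat; split=> //.
    apply: (@fresh_notin_FE _ _ (var_y i)); rewrite ?inE //.
      rewrite size_map /game_length; move: sz (num_z * _); rewrite size_cat /=; lia.
    apply/negP => /suppQ[i' i's /var_y_inj ii']; move: ue.
    by rewrite cat_uniq => /and3P[_ /hasPn /(_ i)]; rewrite ii' inE eqxx /= i's => /(_ isT).
  - by [].
have [Q [A [szQ suppQ cA ay az]]] := IH (ltnW lt_j).
pose z := Ordinal lt_j.
have zQ : var_z z \notin seen Q by apply/negP => /suppQ /=; rewrite ltnn.
have szQL : size Q <= game_length.
  have : j * num_y.+1 <= num_z * num_y.+1 by rewrite leq_mul2r ltnW // orbT.
  by rewrite /game_length; lia.
have Finj : injective (fun i => [set var_z z; var_y i]).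
  by apply: set2_inj => //; exact: var_y_inj.
(* The term [t] pays for the query of [var_z z] alone, the product for the picks after it. *)
have left : num_y_left (num_z - j) = t + num_y_left (num_z - j.+1) * t.+1.
  by rewrite -subnSK.
have [|P [A' [szP suppP sA cA' aA']]] :=
  @pick_answered _ _ Finj (num_y_left (num_z - j.+1)) (rcons Q [set var_z z]) A.
  rewrite cA left leq_add2r -cats1.
  apply: leq_trans (erased_fresh Finj _ _ szQL zQ _) _; last by rewrite muln1.
  by move=> i; rewrite !inE eqxx.
exists (rcons Q [set var_z z] ++ P), A'; split.
- have := num_y_left_mono (leq_subr j.+1 num_z); rewrite -/num_y.
  by rewrite size_cat size_rcons szP mulSn; lia.
- move=> v; rewrite seen_cat seen_rcons !inE => /orP[/orP[/suppQ|/eqP ->]|] //.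
    by case: v => [[i|k]|] // /ltnW.
    by rewrite /= ltnSn.
  move/(subsetP suppP) => /bigcupP[i _]; rewrite !inE => /orP[/eqP ->|/eqP ->] //.
  by rewrite /= ltnSn.
- by [].
- by move=> i; rewrite -cats1; do 2!apply: answered_cat.
- move=> k; rewrite ltnS leq_eqVlt => /orP[/eqP kj|kj].
    have -> : k = z by apply: ord_inj.
    split=> //; apply/answered_cat/answered_rcons.
    by apply: (fresh_notin_FE szQL _ zQ); rewrite inE.
  have [h1 h2] := az k kj; rewrite -cats1; split=> [|i /(subsetP sA) iA].
    by do 2!apply: answered_cat.
  by do 2!apply: answered_cat; apply: h2.
Qed.

Lemma game_won : exists (Q : seq {set vars}) i j, size Q = game_length /\
  forall S, S \in [:: [set var_p]; [set var_y i]; [set var_z j];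
    [set var_p; var_y i]; [set var_p; var_z j]; [set var_z j; var_y i];
    [set var_p; var_y i; var_z j]] -> answered Q S.
Proof.
have [Q [A [szQ suppQ cA ay az]]] := yz_stages (leqnn num_z).
rewrite subnn /= in cA.
have pQ : var_p \notin seen Q by apply/negP => /suppQ.
have szQL : size Q <= game_length by rewrite /game_length; lia.
pose Q1 := rcons Q [set var_p].
have pzi : injective (fun j => [set var_p; var_z j]) by apply: set2_inj => //; exact: var_z_inj.
have pyi : injective (fun i => [set var_p; var_y i]) by apply: set2_inj => //; exact: var_y_inj.
have [|P2 [J [szP2 _ _ cJ aJ]]] := @pick_answered _ _ pzi grid_side Q1 setT.
  rewrite cardsT card_ord /num_z leq_add2r /Q1 -cats1.
  apply: leq_trans (erased_fresh pzi _ _ szQL pQ _) _; last by rewrite muln1.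
  by move=> j; rewrite !inE eqxx.
(* The [1 + grid_side] queries since [p] became visible account for the first term of
   [num_y_left 0]. *)
have [|P3 [A' [szP3 _ sA' cA' aA']]] := @pick_answered _ _ pyi grid_side (Q1 ++ P2) A.
  rewrite cA leq_add2r /Q1 cat_rcons.
  apply: leq_trans (erased_fresh pyi _ _ szQL pQ _) _; last by rewrite /= szP2.
  by move=> i; rewrite !inE eqxx.
have [|P4 [A4 [szP4 _ sA4 cA4 aA4]]] :=
  @pick_answered _ _ pyz_inj 1 ((Q1 ++ P2) ++ P3) (setX A' J).
  rewrite cardsX cA' cJ /Q1 cat_rcons -catA.
  apply: (@leq_trans (t * (1 + 2 * grid_side) + 1 * t.+1)).
    rewrite leq_add2r.
    apply: leq_trans (erased_fresh pyz_inj _ _ szQL pQ _) _.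
      by move=> ij; rewrite !inE eqxx.
    by rewrite /= size_cat szP2 szP3 addnn mul2n.
  by rewrite /grid_side; nia.
have /eqP/cards1P[[i j] A4E] := cA4.
have ijA : (i, j) \in A4 by rewrite A4E inE.
have := subsetP sA4 _ ijA; rewrite inE /= => /andP[iA' jJ].
have iA := subsetP sA' _ iA'.
have [azj azy] := az j (ltn_ord j).
pose Q4 := ((Q1 ++ P2) ++ P3) ++ P4.
have ansQ4 S : S \in [:: [set var_p]; [set var_y i]; [set var_z j];
    [set var_p; var_y i]; [set var_p; var_z j]; [set var_z j; var_y i];
    [set var_p; var_y i; var_z j]] -> answered Q4 S.
  have fromQ S' : answered Q S' -> answered Q4 S'.
    by rewrite /Q4 /Q1 -cats1 -!catA; exact: answered_cat.
  have fromQ1 S' : answered Q1 S' -> answered Q4 S'.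
    by rewrite /Q4 -!catA; exact: answered_cat.
  have fromQ2 S' : answered (Q1 ++ P2) S' -> answered Q4 S'.
    by rewrite /Q4 -(catA (Q1 ++ P2)); exact: answered_cat.
  rewrite !inE; do ![case/orP]; move/eqP->.
  - by apply/fromQ1/answered_rcons/(fresh_notin_FE szQL _ pQ); rewrite inE.
  - exact/fromQ.
  - exact/fromQ.
  - exact/answered_cat/aA'.
  - exact/fromQ2/aJ.
  - exact/fromQ/azy.
  - exact: (aA4 _ ijA).
have szQ4 : size Q4 <= game_length.
  by rewrite !size_cat size_rcons szP2 szP3 szP4 /game_length; lia.
(* Empty sums pad the sequence to the fixed length. *)
exists (Q4 ++ nseq (game_length - size Q4) set0), i, j; split.
  by rewrite size_cat size_nseq subnKC.
by move=> S /ansQ4; exact: answered_cat.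
Qed.

End Game.

(** * Random subset sums and the erasure oracle *)

Section Evaluation.
Local Open Scope nat_scope.
Variables (D : finZmodType) (I : finType).
Implicit Types (b : {ffun I -> D}) (X : {set I}).

Definition eval b X : D := (\sum_(i in X) b i)%R.

Definition shift b (i : I) (c : D) : {ffun I -> D} :=
  [ffun k => if k == i then b k + c else b k]%R.

Lemma eval_shift_in b i c X : i \in X -> eval (shift b i c) X = (eval b X + c)%R.
Proof.
move=> iX; rewrite /eval (bigD1 i) //= (bigD1 i iX) //= ffunE eqxx addrAC.
congr (_ + _ + _)%R; apply: eq_bigr => k /andP[_ /negbTE ki].
by rewrite ffunE ki.
Qed.

Lemma eval_shift_notin b i c X : i \notin X -> eval (shift b i c) X = eval b X.
Proof.
move=> iX; apply: eq_bigr => k kX; rewrite ffunE; case: eqP => // ki.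
by rewrite -ki kX in iX.
Qed.

Lemma shift_inj i c : injective (fun b => shift b i c).
Proof.
move=> b b' /ffunP E; apply/ffunP => k; have := E k; rewrite !ffunE.
by case: eqP => // _ /addIr.
Qed.

(* A sum containing a coordinate that neither the conditioning event [P] nor
   the target set [E] depends on is uniform, hence hits [E] with probability
   at most [m / #|D|]. *)
Lemma fresh_hit (P : pred {ffun I -> D}) (E : {ffun I -> D} -> {set D})
    (i : I) (X : {set I}) (m : nat) :
    i \in X -> (forall b c, P (shift b i c) = P b) ->
    (forall b c, E (shift b i c) = E b) -> (forall b, P b -> #|E b| <= m) ->
  #|D| * #|[set b | P b && (eval b X \in E b)]| <= m * #|[set b | P b]|.
Proof.
move=> iX Psh Esh Em.
rewrite -sum_nat_const.
(* Average over all shifts of coordinate [i]: [P] and [E] stay fixed while [eval b X] runs through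
   [D]. *)
apply: (@leq_trans (\sum_(c : D) \sum_(b | P b) (eval b X + c \in E b)%R)).
  apply: leq_sum => c _.
  rewrite -(card_preimset _ (@shift_inj i c)) -sum1_card big_mkcond [X in _ <= X]big_mkcond.
  apply: leq_sum => b _; rewrite !inE Psh Esh eval_shift_in //.
  by case: (P b) => //=; case: (_ \in _).
rewrite exchange_big /= mulnC -sum_nat_const.
rewrite [X in _ <= X](eq_bigl P); last by move=> b; rewrite inE.
apply: leq_sum => b Pb; apply: leq_trans (Em b Pb).
rewrite -sum1_card [X in _ <= X](reindex_inj (addrI (eval b X))) /=.
by rewrite [X in _ <= X]big_mkcond; apply: leq_sum => c _; exact: leqnn.
Qed.

End Evaluation.

(** Union bound, in counting form. *)
Lemma card_exists_leq (W T : finType) (P : W -> pred T) :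
  (#|[set b | [exists w, P w b]]| <= \sum_w #|[set b | P w b]|)%N.
Proof.
have -> : [set b | [exists w, P w b]] = \bigcup_w [set b | P w b].
  apply/setP => b; rewrite inE; apply/existsP/bigcupP => [[w h]|[w _]].
    by exists w; rewrite ?inE.
  by rewrite inE; exists w.
apply: (big_ind2 (fun (A : {set T}) n => #|A| <= n)%N) => [|A m B n hA hB|//].
  by rewrite cards0.
exact: leq_trans (leq_card_setU A B) (leq_add hA hB).
Qed.

(** * State and transcript of the erasure oracle *)

Section Oracle.
Local Open Scope nat_scope.
Variables (D : finType) (f : D -> bool) (adv : adversary D).
Implicit Types (E : {set D}) (h : seq (D * option bool)) (qs : seq D).

(** What [run_aux] carries along but does not return; a second block of queries resumes from it. *)
Fixpoint state_after E h qs : {set D} * seq (D * option bool) :=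
  if qs is x :: qs' then
    let h' := rcons h (x, if x \in E then None else Some (f x)) in
    state_after (E :|: adv h') h' qs'
  else (E, h).

Lemma size_run_aux E h qs : size (run_aux f adv E h qs) = size qs.
Proof. by elim: qs E h => //= x qs IH E h; rewrite IH. Qed.

Lemma run_aux_cat E h qs qs' : run_aux f adv E h (qs ++ qs') =
  run_aux f adv E h qs
  ++ run_aux f adv (state_after E h qs).1 (state_after E h qs).2 qs'.
Proof. by elim: qs E h => //= x qs IH E h; rewrite IH. Qed.

Lemma state_after_cat E h qs qs' : state_after E h (qs ++ qs') =
  state_after (state_after E h qs).1 (state_after E h qs).2 qs'.
Proof. by elim: qs E h => //= x qs IH E h; rewrite IH. Qed.

Lemma card_state_after t E h qs :
  t_adversary t adv -> #|(state_after E h qs).1| <= #|E| + t * size qs.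
Proof.
move=> advt; elim: qs E h => [|x qs IH] E h /=; first by rewrite muln0 addn0.
apply: leq_trans (IH _ _) _; rewrite mulnS addnA leq_add2r.
by apply: leq_trans (leq_card_setU _ _) _; rewrite leq_add2l advt.
Qed.

Definition transcript E h qs := zip qs (run_aux f adv E h qs).

Lemma transcript_cat E h qs qs' : transcript E h (qs ++ qs') =
  transcript E h qs
  ++ transcript (state_after E h qs).1 (state_after E h qs).2 qs'.
Proof. by rewrite /transcript run_aux_cat zip_cat // size_run_aux. Qed.

Lemma transcript_sound E h qs x b : (x, Some b) \in transcript E h qs -> b = f x.
Proof.
elim: qs E h => //= y qs IH E h; rewrite inE => /orP[/eqP[-> ]|/IH //].
by case: ifP => // _ [].
Qed.

End Oracle.

(** * Recognizing a violation from the answers *)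

Section Detection.
Variable D : finZmodType.
Implicit Types (s : seq (D * option bool)) (x y z : D).

Definition known s x : bool := ((x, Some true) \in s) || ((x, Some false) \in s).

Definition cube_points x y z := [:: x; y; z; x + y; x + z; y + z; x + y + z].

(** The rejection rule, computed from the transcript alone. Points without an answer default to
    false in the violation, but [known] excludes them. *)
Definition caught s : bool := [exists x, exists y, exists z,
  all (known s) (cube_points x y z)
  && violation (fun u => (u, Some true) \in s) x y z].

Lemma caughtP (f : D -> bool) (adv : adversary D) E h qs :
  reflect (exists x y z, all (known (transcript f adv E h qs)) (cube_points x y z)
             /\ violation f x y z)
          (caught (transcript f adv E h qs)).
Proof.
set s := transcript _ _ _ _ _.
have sE x : known s x -> ((x, Some true) \in s) = f x.
  move=> /orP[xs|xs]; first by rewrite xs -(transcript_sound xs).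
  rewrite -(transcript_sound xs); apply/negP => /transcript_sound.
  by rewrite -(transcript_sound xs).
have vE x y z : all (known s) (cube_points x y z) ->
    violation (fun u => (u, Some true) \in s) x y z = violation f x y z.
  move=> /allP ks; rewrite /violation.
  by do ![rewrite sE; last by apply: ks; rewrite !inE eqxx ?orbT].
apply: (iffP existsP) => [[x /existsP[y /existsP[z /andP[k]]]]|[x [y [z [k v]]]]].
  by rewrite vE // => v; exists x, y, z.
by exists x; apply/existsP; exists y; apply/existsP; exists z; rewrite k vE.
Qed.

Lemma known_cat s s' x : known (s ++ s') x = known s x || known s' x.
Proof. by rewrite /known !mem_cat orbACA. Qed.

Lemma caught_cat (f : D -> bool) (adv : adversary D) E h qs qs' :
  caught (transcript f adv E h qs)
  || caught (transcript f adv (state_after f adv E h qs).1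
                            (state_after f adv E h qs).2 qs') ->
  caught (transcript f adv E h (qs ++ qs')).
Proof.
move=> c; apply/caughtP; rewrite transcript_cat.
by case/orP: c => /caughtP [x [y [z [/allP k v]]]]; exists x, y, z; split=> //;
  apply/allP => u /k; rewrite known_cat => ->; rewrite ?orbT.
Qed.

End Detection.

(** * The gadget *)

Section Gadget.
Local Open Scope nat_scope.
Variables (D : finZmodType) (t : nat) (f : D -> bool).

Definition assignment := {ffun vars t -> D}.
(** A guess of the whole game, fixed before any answer so that the tester stays nonadaptive. *)
Definition plan := (game_length t).-tuple {set vars t}.

Definition grid (b : assignment) : bool := [forall i, forall j,
  violation f (b (var_p t)) (b (var_y i)) (b (var_z j))].

Lemma eval1 (b : assignment) v : eval b [set v] = b v.
Proof. by rewrite /eval big_set1. Qed.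

Lemma eval2 (b : assignment) v w : v != w -> eval b [set v; w] = (b v + b w)%R.
Proof. by move=> vw; rewrite /eval big_setU1 ?big_set1 // inE. Qed.

Lemma eval_pyz (b : assignment) i j : eval b [set var_p t; var_y i; var_z j]
  = (b (var_p t) + b (var_y i) + b (var_z j))%R.
Proof. rewrite -eval2 // /eval setUC big_setU1 ?inE //=; exact: addrC. Qed.

Variables (adv : adversary D) (E0 : {set D}) (h0 : seq (D * option bool)).
Hypothesis advt : t_adversary t adv.

Let erased (b : assignment) Q := (state_after f adv E0 h0 (map (eval b) Q)).1.

(* The subset sums are distinct, and under no plan is a sum erased before all its
   variables have been queried. *)
Definition generic (b : assignment) : bool :=
  ~~ [exists w : {set vars t} * {set vars t},
        (w.1 != w.2) && (eval b w.1 == eval b w.2)]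
  && ~~ [exists w : plan * 'I_(game_length t).+1 * {set vars t},
        ~~ (w.2 \subset seen (take w.1.2 w.1.1))
        && (eval b w.2 \in erased b (take w.1.2 w.1.1))].

(** Pulling erased points back along the injective [eval b] gives an instance of the game. Its
    winning sequence is the plan, and the seven answered sums form a violation because [b] is a
    grid. *)
Lemma generic_grid_caught b : generic b -> grid b ->
  exists Q : plan, caught (transcript f adv E0 h0 (map (eval b) Q)).
Proof.
case/andP => /existsPn inj /existsPn blind /forallP gr.
have binj : injective (eval b).
  move=> S S' SS'; apply/eqP; have := inj (S, S').
  by rewrite /= SS' eqxx andbT negbK.
pose FE Q := [set S | eval b S \in erased b Q].
have FE_step Q S : #|FE (rcons Q S) :\: FE Q| <= t.
  rewrite -(card_imset _ binj); set h' := rcons (state_after f adv E0 h0 (map (eval b) Q)).2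
     (eval b S, if eval b S \in erased b Q then None else Some (f (eval b S))).
  apply: leq_trans (advt h'); apply: subset_leq_card; apply/subsetP => x.
  case/imsetP => S'; rewrite !inE => /andP[nin]; rewrite /erased map_rcons -cats1.
  by rewrite state_after_cat /= inE -/(erased b Q) (negbTE nin) /= => ? ->.
have FE_seen Q S : size Q <= game_length t -> S \in FE Q -> S \subset seen Q.
  rewrite inE => szQ SE; apply/negPn/negP => nS.
  (* [generic] speaks of prefixes of plans, so [Q] is extended to a plan. *)
  have szQ' : size (Q ++ nseq (game_length t - size Q) set0) == game_length t.
    by rewrite size_cat size_nseq subnKC.
  have szQ'' : size Q < (game_length t).+1 by [].
  have := blind (Tuple szQ', Ordinal szQ'', S).
  by rewrite /= take_size_cat // nS SE.
have [Q [i [j [szQ ans]]]] := game_won FE_step FE_seen.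
exists (Tuple (introT eqP szQ)) => /=; apply/caughtP.
exists (b (var_p t)), (b (var_y i)), (b (var_z j)); split; last first.
  by have /forallP := gr i; apply.
have kn S : answered FE Q S -> known (transcript f adv E0 h0 (map (eval b) Q)) (eval b S).
  move=> [Q1 [Q2 [-> nin]]]; rewrite map_cat transcript_cat known_cat.
  apply/orP; right; rewrite /transcript /=.
  rewrite inE in nin; rewrite (negbTE nin) /known !inE.
  by case: (f _); rewrite eqxx ?orbT.
apply/allP => u; rewrite !inE; do ![case/orP] => /eqP ->.
- by rewrite -eval1; apply/kn/ans; rewrite !inE eqxx ?orbT.
- by rewrite -eval1; apply/kn/ans; rewrite !inE eqxx ?orbT.
- by rewrite -eval1; apply/kn/ans; rewrite !inE eqxx ?orbT.
- by rewrite -eval2 //; apply/kn/ans; rewrite !inE eqxx ?orbT.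
- by rewrite -eval2 //; apply/kn/ans; rewrite !inE eqxx ?orbT.
- have -> : (b (var_y i) + b (var_z j) = b (var_z j) + b (var_y i))%R by exact: addrC.
  by rewrite -eval2 //; apply/kn/ans; rewrite !inE eqxx ?orbT.
- by rewrite -eval_pyz; apply/kn/ans; rewrite !inE eqxx ?orbT.
Qed.

Definition num_coincidences := #|{: {set vars t} * {set vars t}}|.
Definition num_blind_hits := #|{: plan * 'I_(game_length t).+1 * {set vars t}}|.

(** Union bound: two distinct sums coincide with probability at most [1 / #|D|], and a sum with an
    unseen variable must hit one of at most [#|E0| + t * game_length t] erased points. *)
Lemma card_nongeneric : #|D| * #|[set b | ~~ generic b]| <=
  (num_coincidences + num_blind_hits * (#|E0| + t * game_length t))
  * #|{: assignment}|.
Proof.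
have fresh i (X : {set vars t}) (E : assignment -> {set D}) m : i \in X ->
    (forall b c, E (shift b i c) = E b) -> (forall b, #|E b| <= m) ->
    #|D| * #|[set b : assignment | eval b X \in E b]| <= m * #|{: assignment}|.
  move=> iX Esh Em.
  have := @fresh_hit D (vars t) xpredT E i X m iX (fun _ _ => erefl) Esh
    (fun b _ => Em b).
  move=> h; apply: leq_trans h _.
  by rewrite -cardsT leq_mul2l subset_leq_card ?orbT ?subsetT.
have sub : [set b | ~~ generic b] \subset
   [set b | [exists w : {set vars t} * {set vars t},
        (w.1 != w.2) && (eval b w.1 == eval b w.2)]] :|:
   [set b | [exists w : plan * 'I_(game_length t).+1 * {set vars t},
        ~~ (w.2 \subset seen (take w.1.2 w.1.1))
        && (eval b w.2 \in erased b (take w.1.2 w.1.1))]].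
  by apply/subsetP => b; rewrite !inE negb_and !negbK.
apply: leq_trans (leq_mul (leqnn _) (subset_leq_card sub)) _.
apply: leq_trans (leq_mul (leqnn _) (leq_of_leqif (leq_card_setU _ _))) _.
rewrite mulnDr mulnDl; apply: leq_add.
  apply: leq_trans (leq_mul (leqnn _) (card_exists_leq _)) _.
  rewrite /num_coincidences big_distrr -[X in _ <= X]sum_nat_const.
  apply: leq_sum => -[S S'] _ /=.
  have [->|ne] /= := eqVneq S S'.
    by rewrite (_ : [set b | _] = set0) ?cards0 ?muln0 //; apply/setP => b; rewrite !inE.
  have half (X X' : {set vars t}) i : i \in X -> i \notin X' ->
      #|D| * #|[set b : assignment | eval b X == eval b X']| <= #|{: assignment}|.
    move=> iX iX'; rewrite -[X in _ <= X]mul1n.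
    have -> : [set b : assignment | eval b X == eval b X']
        = [set b : assignment | eval b X \in [set eval b X']].
      by apply/setP => b; rewrite !inE.
    apply: (fresh i) => // b; last by rewrite cards1.
    by move=> c; rewrite eval_shift_notin.
  have [/subsetPn[i iS iS']|/negPn SS'] := boolP (~~ (S \subset S')).
    exact: half iS iS'.
  have /subsetPn[i iS' iS] : ~~ (S' \subset S) by move: ne; rewrite eqEsubset SS'.
  apply: leq_trans (half _ _ _ iS' iS); rewrite leq_mul2l subset_leq_card ?orbT //.
  by apply/subsetP => b; rewrite !inE eq_sym.
apply: leq_trans (leq_mul (leqnn _) (card_exists_leq _)) _.
rewrite /num_blind_hits -mulnA big_distrr -[X in _ <= X]sum_nat_const.
apply: leq_sum => -[[Q k] S] _ /=.
have [sS|/subsetPn[i iS iQ]] /= := boolP (S \subset _).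
  by rewrite (_ : [set b | _] = set0) ?cards0 ?muln0 //; apply/setP => b; rewrite !inE.
apply: (fresh i) => // b.
  (* The erased set is a function of the points queried so far, none of which involves [i]. *)
  move=> c; rewrite /erased; congr (state_after _ _ _ _ _).1.
  apply/eq_in_map => X XQ; apply: eval_shift_notin; apply: contra iQ => iX.
  rewrite /seen; move: XQ; elim: (take _ _) => //= Y s IH; rewrite inE big_cons inE.
  by case/orP => [/eqP <-|/IH ->]; rewrite ?iX ?orbT.
apply: leq_trans (card_state_after f E0 h0 _ advt) _.
rewrite leq_add2l leq_mul2l size_map size_take size_tuple.
by case: ifP => [/ltnW ->|_]; rewrite ?leqnn orbT.
Qed.

(** Every generic grid is caught by at least one plan, so a random plan loses only a factor
    depending on [t]. *)
Lemma caught_plans_ge :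
  #|[set b | grid b]| <= #|[set b | ~~ generic b]| +
    #|[set c : assignment * plan |
        caught (transcript f adv E0 h0 (map (eval c.1) c.2))]|.
Proof.
rewrite -leq_subLR.
pose G := [set b | grid b] :\: [set b | ~~ generic b].
apply: (@leq_trans #|G|).
  rewrite leq_subLR -(cardsID [set b | ~~ generic b] [set b | grid b]) leq_add2r.
  by rewrite subset_leq_card // subsetIr.
apply: (@leq_trans #|[set c.1 | c in [set c : assignment * plan |
        caught (transcript f adv E0 h0 (map (eval c.1) c.2))]]|); last exact: leq_imset_card.
apply/subset_leq_card/subsetP => b; rewrite !inE negbK => /andP[gb grb].
have [Q cQ] := generic_grid_caught gb grb.
by apply/imsetP; exists (b, Q); rewrite ?inE.
Qed.

End Gadget.

(** * Counting fully violating gadgets *)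

Section PowerMean.
Local Open Scope nat_scope.

(** A rearrangement of [(a - b) * (a ^ k - b ^ k) >= 0]. *)
Lemma chebyshev2 a b k :
  a * b ^ k + b * a ^ k <= a ^ k.+1 + b ^ k.+1.
Proof.
wlog ab : a b / a <= b => [h|].
  by have [/h //|/ltnW/h] := leqP a b; rewrite addnC [X in _ <= X -> _]addnC.
rewrite !expnS.
have : a ^ k <= b ^ k by case: k => // k; rewrite leq_exp2r.
by move: (a ^ k) (b ^ k) => u v uv; nia.
Qed.

(** Induction on [k] by Chebyshev's sum inequality, that is, [chebyshev2] summed over all pairs. *)
Lemma power_mean (T : finType) (F : T -> nat) k :
  (\sum_x F x) ^ k.+1 <= #|T| ^ k * \sum_x F x ^ k.+1.
Proof.
elim: k => [|k IH]; first by rewrite mul1n expn1; under [X in _ <= X]eq_bigr do rewrite expn1.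
rewrite [X in X <= _]expnS (expnSr #|T|) -mulnA.
apply: leq_trans (leq_mul (leqnn _) IH) _; rewrite mulnCA leq_mul2l; apply/orP; right.
rewrite -(leq_pmul2l (isT : 0 < 2)) !mul2n -!addnn.
have E : (\sum_x F x) * (\sum_x F x ^ k.+1) = \sum_x \sum_y F x * F y ^ k.+1.
  by rewrite big_distrl; apply: eq_bigr => x _; rewrite big_distrr.
have E1 : \sum_(x : T) \sum_(y : T) F x ^ k.+2 = #|T| * \sum_x F x ^ k.+2.
  by under eq_bigr do rewrite sum_nat_const; rewrite -big_distrr.
have E2 : \sum_(x : T) \sum_y F y ^ k.+2 = #|T| * \sum_x F x ^ k.+2.
  by rewrite sum_nat_const.
rewrite -{1}E1 -E2 {1}E {1}E [X in _ + X <= _]exchange_big -!big_split.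
apply: leq_sum => x _; rewrite -!big_split; apply: leq_sum => y _; exact: chebyshev2.
Qed.

End PowerMean.

(** * Lower bounds on the number of grids *)

Section GridCount.
Local Open Scope nat_scope.
Variables (D : finZmodType) (t : nat) (f : D -> bool).
Let N := #|D|.
Let n := num_y t.
Let m := num_z t.
Let W x y z : nat := violation f x y z.

Lemma card_assignment : #|{: assignment D t}| = N ^ #|vars t|.
Proof. exact: card_ffun. Qed.

Lemma card_vars : #|vars t| = (n + m).+1.
Proof. by rewrite card_option card_sum !card_ord. Qed.

Lemma prod_bool (J : finType) (P : pred J) : \prod_j (P j : nat) = [forall j, P j].
Proof.
have [/forallP h|/forallPn[j /negbTE h]] := boolP [forall j, P j].
  by rewrite big1 // => j _; rewrite h.
by rewrite (bigD1 j) //= h.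
Qed.

Definition glue (u : D * {ffun 'I_n -> D} * {ffun 'I_m -> D}) : assignment D t :=
  [ffun v => match v with
             | None => u.1.1 | Some (inl i) => u.1.2 i | Some (inr j) => u.2 j end].

Definition unglue (b : assignment D t) : D * {ffun 'I_n -> D} * {ffun 'I_m -> D} :=
  (b (var_p t), [ffun i => b (var_y i)], [ffun j => b (var_z j)]).

Lemma glueK : cancel glue unglue.
Proof.
by move=> [[p ys] zs]; congr (_, _, _); rewrite ?ffunE //; apply/ffunP => i; rewrite !ffunE.
Qed.

Lemma unglueK : cancel unglue glue.
Proof. by move=> b; apply/ffunP => -[[i|j]|]; rewrite !ffunE. Qed.

(** Once [p] and the [y_i] are fixed, the [z_j] obey independent identical constraints. *)
Lemma card_grid : #|[set b | grid (t:=t) f b]| =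
  \sum_(u : D * {ffun 'I_n -> D}) (\sum_z \prod_i W u.1 (u.2 i) z) ^ m.
Proof.
transitivity (\sum_(b : assignment D t) (grid f b : nat)).
  by rewrite -sum1_card big_mkcond; apply: eq_bigr => b _; rewrite inE; case: grid.
rewrite (reindex glue) /=; last by exists unglue => x _; rewrite (glueK, unglueK).
rewrite -(pair_bigA_idem _ (fun u zs => grid f (glue (u, zs)) : nat)) //=.
apply: eq_bigr => u _.
rewrite -[m in RHS]card_ord -prod_nat_const bigA_distr_bigA /=.
apply: eq_bigr => zs _; rewrite exchange_big /= /grid -prod_bool.
apply: eq_bigr => i _; rewrite -prod_bool; apply: eq_bigr => j _.
by rewrite !ffunE.
Qed.

(** For fixed [p] a grid is a complete bipartite pattern of violating pairs. The power mean
    inequality is used with exponent [n] over pairs [(p, z)], then with exponent [m] over [p] and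
    all [y_i]. *)
Lemma grid_dense K : N ^ 3 <= K * violations f ->
  #|{: assignment D t}| <= K ^ (n * m) * #|[set b | grid (t:=t) f b]|.
Proof.
move=> KV.
pose U := \sum_(u : D * {ffun 'I_n -> D}) \sum_z \prod_i W u.1 (u.2 i) z.
have UE : U = \sum_(u : D * D) (\sum_y W u.1 y u.2) ^ n.
  rewrite /U -(pair_bigA_idem _ (fun p (ys : {ffun 'I_n -> D}) => \sum_z \prod_i W p (ys i) z)) //=.
  rewrite -(pair_bigA_idem _ (fun p z => (\sum_y W p y z) ^ n)) //=.
  apply: eq_bigr => p _; rewrite exchange_big; apply: eq_bigr => z _ /=.
  by rewrite -[n in RHS]card_ord -prod_nat_const bigA_distr_bigA.
have VE : violations f = \sum_(u : D * D) \sum_y W u.1 y u.2.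
  rewrite -(pair_bigA_idem _ (fun p z => \sum_y W p y z)) //=.
  by apply: eq_bigr => p _; rewrite exchange_big.
have N0 : 0 < N by apply/card_gt0P; exists 0%R.
have m_gt0 : 0 < m by rewrite /m /num_z /grid_side; lia.
have n_gt0 : 0 < n.
  rewrite /n /num_y; apply: leq_trans _ (num_y_left_mono t (leq0n _)).
  by rewrite /= /grid_side; lia.
have hU : violations f ^ n <= N ^ (2 * n.-1) * U.
  rewrite UE VE -(prednK n_gt0); apply: leq_trans (power_mean _ _) _.
  by rewrite card_prod mulnn -expnM.
have hG : U ^ m <= N ^ (n.+1 * m.-1) * #|[set b | grid (t:=t) f b]|.
  rewrite card_grid -[in X in _ ^ X](prednK m_gt0).
  apply: leq_trans (power_mean _ _) _.
  rewrite card_prod card_ffun card_ord -expnS -expnM.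
  by rewrite (prednK m_gt0).
have e : N ^ (3 * (n * m)) <= K ^ (n * m) *
    (N ^ (2 * n.-1 * m + n.+1 * m.-1) * #|[set b | grid (t:=t) f b]|).
  rewrite expnM; apply: (@leq_trans ((K * violations f) ^ (n * m))).
    by rewrite leq_exp2r ?muln_gt0 ?n_gt0.
  rewrite expnMn leq_mul2l; apply/orP; right; rewrite expnM.
  apply: (@leq_trans ((N ^ (2 * n.-1) * U) ^ m)); first by rewrite leq_exp2r.
  by rewrite expnMn expnD (expnM N (2 * n.-1) m) -mulnA leq_mul2l hG orbT.
have N0' : 0 < N ^ (2 * n.-1 * m + n.+1 * m.-1) by rewrite expn_gt0 N0.
rewrite -(leq_pmul2l N0') card_assignment -expnD card_vars mulnCA.
rewrite (_ : _ + (n + m).+1 = 3 * (n * m)) //.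
by move: n m n_gt0 m_gt0 => [|n'] // [|m'] // _ _; rewrite /=; lia.
Qed.

(** As [f] is [g] plus the indicator of [S], a triple is violating if [p] is the only one of its
    seven sums in [S]. Given [p] in [S], a union bound over the other sums leaves probability at
    least one half. *)
Lemma grid_sparse (g : D -> bool) :
    (forall x y z, violation g x y z = false) ->
    2 ^ #|vars t|.+1 * #|[set x | f x != g x]| <= N ->
  #|[set x | f x != g x]| * #|{: assignment D t}|
    <= 2 * N * #|[set b | grid (t:=t) f b]|.
Proof.
set S := [set x | f x != g x] => nov Ssmall.
have N0 : 0 < N by apply/card_gt0P; exists 0%R.
pose P (b : assignment D t) := b (var_p t) \in S.
have Pcount : #|S| * #|{: assignment D t}| <= N * #|[set b | P b]|.
  (* [fresh_hit] bounds from above only, so it is applied to the complement of [S]. *)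
  have h : N * #|~: [set b | P b]| <= #|~: S| * #|{: assignment D t}|.
    have h0 := @fresh_hit D (vars t) xpredT (fun=> ~: S) (var_p t) [set var_p t]
      #|~: S| (set11 _) (fun _ _ => erefl) (fun _ _ => erefl) (fun _ _ => leqnn _).
    apply: leq_trans (leq_trans _ h0) _.
      rewrite leq_mul2l subset_leq_card ?orbT //; apply/subsetP => b.
      by rewrite !inE eval1 /P inE.
    by rewrite -cardsT leq_mul2l subset_leq_card ?orbT ?subsetT.
  move: h.
  have := cardsC S; have := cardsC [set b | P b].
  rewrite -/N.
  move: (#|S|) (#|~: S|) (#|[set b | P b]|) (#|~: [set b | P b]|) => s s' p p'.
  move: (#|{: assignment D t}|) => A <- <-; nia.
pose badX X (b : assignment D t) :=
  [&& X != [set var_p t], X != set0, P b & eval b X \in S].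
have badcount : 2 * #|[set b | [exists X, badX X b]]| <= #|[set b | P b]|.
  rewrite -(leq_pmul2l N0) mulnCA.
  apply: (@leq_trans (2 * \sum_(X : {set vars t}) #|S| * #|[set b | P b]|)).
    rewrite leq_mul2l; apply/orP; right.
    apply: leq_trans (leq_mul (leqnn _) (card_exists_leq _)) _.
    rewrite big_distrr; apply: leq_sum => X _ /=.
    have [X1|X1] := boolP ((X != [set var_p t]) && (X != set0)); last first.
      rewrite (_ : [set b | _] = set0) ?cards0 ?muln0 //.
      by apply/setP => b; rewrite !inE /badX andbA (negbTE X1).
    have /subsetPn[i iX] : ~~ (X \subset [set var_p t]) by rewrite subset1 negb_or.
    rewrite inE => ip.
    rewrite (_ : [set b | _] = [set b | P b && (eval b X \in S)]); last first.
      by apply/setP => b; rewrite inE [RHS]inE /badX andbA X1.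
    apply: (fresh_hit iX) => // b c; rewrite /P ffunE eq_sym (negbTE ip) //.
  rewrite sum_nat_const -[#|{: {set _}}|]cardsT -powersetT card_powerset cardsT.
  by rewrite !mulnA -expnS leq_mul2r Ssmall orbT.
have sub : [set b | P b] \subset [set b | [exists X, badX X b]] :|: [set b | grid (t:=t) f b].
  apply/subsetP => b; rewrite !inE => Pb; apply/orP.
  have [|/existsPn nb] := boolP [exists X, badX X b]; [by left|right].
  apply/forallP => i; apply/forallP => j.
  have notS (X : {set vars t}) v : v \in X -> v != var_p t -> (eval b X \in S) = false.
    move=> vX vp; have := nb X; rewrite /badX Pb => /negbTE.
    rewrite (_ : X != set0); last by apply/set0Pn; exists v.
    rewrite (_ : X != [set var_p t]) //; apply: contraNneq vp => XE.
    by move: vX; rewrite XE inE.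
  have fE : f =1 (fun u => g u (+) (u \in S)).
    by move=> u; rewrite inE; case: (f u); case: (g u).
  rewrite (eq_violation _ _ _ fE) violation_add nov /violation.
  rewrite (_ : b (var_p t) \in S) // -eval_pyz -!eval2 //.
  rewrite -(eval1 b (var_y i)) -(eval1 b (var_z j)).
  rewrite (notS _ _ (set11 (var_y i))) // (notS _ _ (set11 (var_z j))) //.
  rewrite !(notS _ _ (set22 _ (var_y i))) // !(notS _ _ (set22 _ (var_z j))) //.
  by rewrite (notS _ (var_z j)) // !inE eqxx orbT.
have := subset_leq_card sub.
have := leq_of_leqif
  (leq_card_setU [set b | [exists X, badX X b]] [set b | grid (t:=t) f b]).
move=> h1 h2; apply: leq_trans Pcount _; rewrite -mulnA mulnCA leq_mul2l; lia.
Qed.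

End GridCount.

(** * The tester *)

(** The factor 34 serves [violations_close]. The power of 2 serves [grid_sparse], with one extra
    factor 2 for the distance bound [2 * violations f]. *)
Definition dense_bound (t : nat) : nat := (34 * 2 ^ (#|vars t|).+2)%N.
Definition grid_bound (t : nat) : nat := (2 * dense_bound t ^ (num_y t * num_z t))%N.

(** If violations are dense, the bound holds even without [eps]. Otherwise [f] is close to some
    quadratic [g], and farness gives the set of differences density at least [eps]. *)
Lemma grid_far (R : realType) (t d : nat) (eps : R) (f : cube d -> bool) :
    0 < eps < 1 -> far eps (@quadratic d) f ->
  eps * #|{: assignment (cube d) t}|%:R
    <= (grid_bound t)%:R * #|[set b | grid (t:=t) f b]|%:R.
Proof.
move=> /andP[eps0 eps1] farf.
have N0 : (0 < #|cube d|)%N by apply/card_gt0P; exists 0.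
have K0 : (0 < dense_bound t)%N by rewrite /dense_bound muln_gt0 expn_gt0.
have [dense|sparse] := leqP (#|cube d| ^ 3) (dense_bound t * violations f).
  have h := grid_dense t dense.
  apply: (@le_trans _ _ #|{: assignment (cube d) t}|%:R).
    by rewrite ler_piMl ?ler0n // ltW.
  rewrite -natrM ler_nat; apply: leq_trans h _.
  by rewrite leq_mul2r leq_pmull ?orbT.
have [|g quadg gdist] := @violations_close d f.
  apply: leq_ltn_trans sparse; rewrite /dense_bound leq_mul2r.
  by rewrite leq_pmulr ?expn_gt0 ?orbT.
have nov x y z : violation g x y z = false by exact: quadratic_violation.
have Ssmall : (2 ^ #|vars t|.+1 * #|[set x | f x != g x]| <= #|cube d|)%N.
  rewrite -(@leq_pmul2r (#|cube d| ^ 2)) ?expn_gt0 ?N0 // -mulnA -expnS.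
  apply: leq_trans (leq_mul (leqnn _) gdist) _; apply: leq_trans _ (ltnW sparse).
  rewrite mulnA -expnSr leq_mul2r /dense_bound; apply/orP; right.
  by rewrite leq_pmull.
have := @grid_sparse (cube d) t f g nov Ssmall.
have := farf g quadg.
set s := #|[set x | _ != _]|; set A := #|{: assignment _ _}|; set gr := #|[set b | grid _ _]|.
move=> farS h.
have {}h : s%:R * A%:R <= 2 * #|cube d|%:R * gr%:R :> R by rewrite -!natrM ler_nat.
have gb2 : 2 <= (grid_bound t)%:R :> R.
  by rewrite ler_nat /grid_bound leq_pmulr // expn_gt0 K0.
apply: (@le_trans _ _ (2 * gr%:R)); last by rewrite ler_wpM2r ?ler0n.
have N0' : 0 < #|cube d|%:R :> R by rewrite ltr0n.
rewrite -(ler_pM2l N0') mulrA [_ * eps]mulrC mulrA [_ * 2]mulrC.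
by apply: le_trans h; rewrite ler_wpM2r ?ler0n.
Qed.

(** * Repeating the gadget *)

Section Repetition.
Variables (R : realType) (d t : nat) (f : cube d -> bool) (adv : adversary (cube d)).
Hypothesis advt : t_adversary t adv.

Implicit Types (E : {set cube d}) (h : seq (cube d * option bool)).

Definition coins : finType := (assignment (cube d) t * plan t)%type.

Definition gadget (c : coins) : seq (cube d) := map (eval c.1) c.2.

Definition all_gadgets (s : seq coins) : seq (cube d) := flatten (map gadget s).

Lemma size_gadget c : size (gadget c) = game_length t.
Proof. by rewrite size_map size_tuple. Qed.

Lemma size_all_gadgets s : size (all_gadgets s) = (size s * game_length t)%N.
Proof. by elim: s => //= c s IH; rewrite size_cat size_gadget IH mulSn. Qed.

(** The hit bound holds from any history and any state with at most [T] erasures, so the first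
    gadget is split off and its final state handed on, with at most [t * game_length t] new
    erasures. *)
Lemma missed_le (x : R) (T K : nat) :
    x <= 1 ->
    (forall E h, (#|E| <= T)%N -> x * #|{: coins}|%:R <=
       #|[set c : coins | caught (transcript f adv E h (gadget c))]|%:R) ->
  forall E h, (#|E| + K * (t * game_length t) <= T)%N ->
  #|[set r : K.-tuple coins | ~~ caught (transcript f adv E h (all_gadgets r))]|%:R
    <= (1 - x) ^+ K * #|{: K.-tuple coins}|%:R.
Proof.
move=> x1 hit; elim: K => [|K IH] E h hE.
  by rewrite expr0 mul1r ler_nat max_card.
pose st c := state_after f adv E h (gadget c).
pose miss c := ~~ caught (transcript f adv E h (gadget c)).
pose missr c (r : K.-tuple coins) :=
  ~~ caught (transcript f adv (st c).1 (st c).2 (all_gadgets r)).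
have step : (#|[set r : K.+1.-tuple coins |
      ~~ caught (transcript f adv E h (all_gadgets r))]|
    <= \sum_(c | miss c) #|[set r | missr c r]|)%N.
  have split_inj : injective (fun r : K.+1.-tuple coins => (thead r, behead_tuple r)).
    move=> r r' [e1 e2]; rewrite (tuple_eta r) (tuple_eta r') e1.
    by apply: val_inj; rewrite /= e2.
  rewrite -(card_imset _ split_inj).
  apply: (@leq_trans #|[set u : coins * K.-tuple coins | miss u.1 && missr u.1 u.2]|).
    apply/subset_leq_card/subsetP => u /imsetP[r]; rewrite inE => nc ->; rewrite inE /=.
    rewrite /miss /missr -negb_or; apply: contra nc.
    have -> : all_gadgets r = gadget (thead r) ++ all_gadgets (behead_tuple r).
      by case/tupleP: r => c r; rewrite theadE.
    exact: caught_cat.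
  rewrite -sum1_card (eq_bigl (fun u => miss u.1 && missr u.1 u.2));
    last by move=> u; rewrite inE.
  rewrite -(pair_big_dep miss missr (fun _ _ => 1%N)) /=.
  by apply: leq_sum => c _; rewrite sum1_card cardsE.
have hmiss : #|[set c | miss c]|%:R <= (1 - x) * #|{: coins}|%:R.
  have := hit E h (leq_trans (leq_addr _ _) hE).
  have := cardsC [set c : coins | caught (transcript f adv E h (gadget c))].
  rewrite (_ : ~: _ = [set c | miss c]); last by apply/setP => c; rewrite !inE.
  by move=> /(congr1 (fun n => n%:R : R)); rewrite natrD; lra.
have card_st c : (#|(st c).1| + K * (t * game_length t) <= T)%N.
  apply: leq_trans hE; rewrite mulSn addnA leq_add2r.
  by rewrite -(size_gadget c) card_state_after.
apply: (@le_trans _ _ (\sum_(c | miss c) ((1 - x) ^+ K * #|{: K.-tuple coins}|%:R))).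
  apply: (@le_trans _ _ (\sum_(c | miss c) #|[set r | missr c r]|)%:R); first by rewrite ler_nat.
  by rewrite natr_sum; apply: ler_sum => c _; exact: IH.
rewrite sumr_const !card_tuple exprS expnS natrM -[leLHS]mulr_natr.
rewrite (_ : #|miss| = #|[set c | miss c]|); last by rewrite cardsE.
set q := (1 - x) ^+ K; set B := (#|_| ^ K)%:R.
have -> : (1 - x) * q * (#|{: coins}|%:R * B) = q * B * ((1 - x) * #|{: coins}|%:R) by ring.
by rewrite ler_wpM2l // mulr_ge0 // exprn_ge0 // subr_ge0.
Qed.

End Repetition.

(** Induction by [(1 - x) * (1 + (K + 1) * x) <= 1 + K * x]. *)
Lemma bernoulli_inv (R : realFieldType) (x : R) K :
  0 <= x <= 1 -> (1 - x) ^+ K * (1 + K%:R * x) <= 1.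
Proof.
move=> /andP[x0 x1]; elim: K => [|K IH]; first by rewrite mul0r addr0 mulr1.
apply: le_trans IH; rewrite exprSr -mulrA ler_wpM2l ?exprn_ge0 ?subr_ge0 //.
rewrite -natr1; have : 0 <= (K%:R : R) by rewrite ler0n.
nra.
Qed.

Lemma repetition_third (R : realFieldType) (x : R) K :
  0 <= x <= 1 -> 2 <= K%:R * x -> (1 - x) ^+ K <= 1 / 3.
Proof.
move=> x01 Kx; have := bernoulli_inv K x01.
have : 0 <= (1 - x) ^+ K by case/andP: x01 => _ x1; rewrite exprn_ge0 // subr_ge0.
move: (_ ^+ _) => q q0; move: (K%:R * x) Kx => k; nra.
Qed.

Lemma two_thirds_le (R : realFieldType) (q m n : R) :
  q <= 1 / 3 -> 0 <= n -> m <= q * n -> 2 / 3 * n <= n - m.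
Proof. by move=> *; nra. Qed.

(** Grids have probability at least [eps / grid_bound t]. On a large cube at most half of this is
    lost to nongeneric assignments, and guessing the plan costs the factor [#|{: plan t}|]. *)
Lemma gadget_hit (R : realType) (t d : nat) (eps : R) (f : cube d -> bool)
    (adv : adversary (cube d)) (E : {set cube d}) h (T : nat) :
    0 < eps < 1 -> far eps (@quadratic d) f -> t_adversary t adv -> (#|E| <= T)%N ->
    2 * (grid_bound t)%:R *
      (num_coincidences t + num_blind_hits t * (T + t * game_length t))%:R
      <= eps * #|cube d|%:R ->
  eps / (2 * (grid_bound t)%:R * #|{: plan t}|%:R) * #|{: coins d t}|%:R
    <= #|[set c : coins d t | caught (transcript f adv E h (gadget c))]|%:R.
Proof.
move=> eps01 farf advt ET Nbig.
have hgrid := grid_far t eps01 farf.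
have hng := @card_nongeneric (cube d) t f adv E h advt.
have hc := @caught_plans_ge (cube d) t f adv E h advt.
have N0 : 0 < #|cube d|%:R :> R by rewrite ltr0n; apply/card_gt0P; exists 0.
have P0 : 0 < #|{: plan t}|%:R :> R.
  by rewrite ltr0n; apply/card_gt0P; exists [tuple of nseq _ set0].
have G0 : 0 < (grid_bound t)%:R :> R.
  by rewrite ltr0n /grid_bound /dense_bound muln_gt0 expn_gt0 muln_gt0 expn_gt0.
have {}hng : #|cube d|%:R * #|[set b | ~~ generic (t:=t) f adv E h b]|%:R <=
    (num_coincidences t + num_blind_hits t * (T + t * game_length t))%:R
    * #|{: assignment (cube d) t}|%:R :> R.
  rewrite -!natrM ler_nat; apply: leq_trans hng _.
  by rewrite leq_mul2r leq_add2l leq_mul2l leq_add2r ET !orbT.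
rewrite -(ler_nat R) natrD in hc.
rewrite /coins card_prod natrM.
move: hgrid hng hc Nbig.
set a := #|{: assignment _ _}|%:R; set G := (grid_bound t)%:R.
set P := #|{: plan t}|%:R; set g := #|[set b | grid _ _]|%:R.
set ng := #|[set b | ~~ _]|%:R; set ca := #|[set c | caught _]|%:R.
set M := (num_coincidences t + _)%:R; set N := #|cube d|%:R => hgrid hng hc Nbig.
have -> : eps / (2 * G * P) * (a * P) = eps * a / (2 * G).
  by field; rewrite !gt_eqF.
rewrite ler_pdivrMr ?mulr_gt0 //.
have a0 : 0 <= a by exact: ler0n.
have : 2 * G * ng <= eps * a.
  rewrite -(ler_pM2l N0) (_ : N * (2 * G * ng) = 2 * G * (N * ng)); last by ring.
  apply: le_trans (_ : 2 * G * (M * a) <= _); first by rewrite ler_wpM2l // mulr_ge0 // ltW.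
  by rewrite mulrA (_ : N * (eps * a) = eps * N * a) ?ler_wpM2r //; ring.
have : G * g <= G * (ng + ca) by rewrite ler_pM2l.
by rewrite mulrDr; lra.
Qed.

Theorem theorem1p4 (R : realType) (t : nat) :
  exists C : R,
    forall eps : R, 0 < eps < 1 ->
    exists d0 : nat, forall d : nat, (d0 <= d)%N ->
      exists (Omega : finType) (qs : Omega -> seq (cube d))
             (dec : Omega -> seq (option bool) -> bool),
        (forall r : Omega, (size (qs r))%:R <= C / eps) /\
        oe_tester_1sided t eps (@quadratic d) qs dec.
Proof.
pose G : R := 2 * (grid_bound t)%:R * #|{: plan t}|%:R.
pose L := game_length t.
(* There are [K <= 2 * G / eps + 1 <= (2 * G + 1) / eps] gadgets of [L] queries. *)
exists ((2 * G + 1) * L%:R) => eps eps01; have /andP[eps0 eps1] := eps01.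
(* Makes [K * (eps / G)] at least 2, as [repetition_third] requires. *)
pose K := (Num.truncn (2 * G / eps)).+1.
(* Bounds the erasures of the whole run. *)
pose T := (K * (t * L))%N.
pose M := (num_coincidences t + num_blind_hits t * (T + t * L))%N.
(* The cube has [2 ^ d > d >= d0] points, enough for [gadget_hit]. *)
pose d0 := (Num.truncn (2 * (grid_bound t)%:R * M%:R / eps)).+1.
exists d0 => d d0d.
exists (K.-tuple (coins d t) : finType),
  (fun r : K.-tuple (coins d t) => all_gadgets r),
  (fun (r : K.-tuple (coins d t)) ans => ~~ caught (zip (all_gadgets r) ans)).
have gb0 : 0 < (grid_bound t)%:R :> R.
  by rewrite ltr0n /grid_bound /dense_bound muln_gt0 expn_gt0 muln_gt0 expn_gt0.
have P0 : 0 < #|{: plan t}|%:R :> R.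
  by rewrite ltr0n; apply/card_gt0P; exists [tuple of nseq _ set0].
have G0 : 0 < G by rewrite /G !mulr_gt0.
have Omega0 : (0 < #|{: K.-tuple (coins d t)}|)%N.
  by apply/card_gt0P; exists [tuple of nseq K ([ffun=> 0], [tuple of nseq _ set0])].
have Omega0' : 0 < #|{: K.-tuple (coins d t)}|%:R :> R by rewrite ltr0n.
split=> [r|].
  rewrite size_all_gadgets size_tuple natrM mulrAC ler_wpM2r ?ler0n //.
  have -> : K%:R = (Num.truncn (2 * G / eps))%:R + 1 :> R by rewrite natr1.
  rewrite [leRHS](_ : _ = 2 * G / eps + eps^-1); last by field; rewrite gt_eqF.
  apply: lerD.
    by rewrite truncn_le divr_ge0 ?mulr_ge0 // ltW.
  by rewrite invf_ge1 // ltW.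
split=> [f quadf adv advt|f farf adv advt].
  rewrite /prob (_ : [set r | _] = setT); first by rewrite cardsT divff // gt_eqF.
  (* Rejection exhibits a genuine violation, which a quadratic function never has. *)
  apply/setP => r; rewrite !inE; apply/negP => /caughtP[x [y [z [_]]]].
  by rewrite quadratic_violation.
have truncnS (y : R) : y <= (Num.truncn y).+1%:R by rewrite ltW // -truncn_le_nat.
pose x : R := eps / G.
have hit (E : {set cube d}) h : (#|E| <= T)%N -> x * #|{: coins d t}|%:R <=
     #|[set c : coins d t | caught (transcript f adv E h (gadget c))]|%:R.
  move=> ET; apply: gadget_hit eps01 farf advt ET _; rewrite -/L -/M.
  rewrite [leRHS]mulrC -ler_pdivrMr //.
  apply: (@le_trans _ _ d0%:R); first exact: truncnS.
  rewrite ler_nat; apply: leq_trans d0d _.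
  by rewrite card_ffun card_bool card_ord ltnW // ltn_expl.
have x0 : 0 <= x by rewrite divr_ge0 // ltW.
(* The hit bound at the empty state compares [x] with a probability. *)
have x1 : x <= 1.
  have c0 : 0 < #|{: coins d t}|%:R :> R.
    by rewrite ltr0n; apply/card_gt0P; exists ([ffun=> 0], [tuple of nseq _ set0]).
  rewrite -(ler_pM2r c0) mul1r.
  apply: le_trans (hit set0 [::] _) _; first by rewrite cards0.
  by rewrite ler_nat max_card.
have := missed_le advt x1 hit (K := K) [::] (E := set0).
rewrite cards0 leqnn => /(_ isT).
set miss := #|_| => hmiss.
have Kx : 2 <= K%:R * x.
  rewrite /x mulrA ler_pdivlMr // -ler_pdivrMr //; exact: truncnS.
have x01 : 0 <= x <= 1 by rewrite x0.
rewrite /prob ler_pdivlMr //.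
have := cardsC [set r : K.-tuple (coins d t) |
  ~~ caught (transcript f adv set0 [::] (all_gadgets r))].
rewrite -/miss => /(congr1 (fun n => n%:R : R)); rewrite natrD => tot.
rewrite (_ : #|[set r | _]|%:R = #|{: K.-tuple (coins d t)}|%:R - miss%:R); last first.
  by rewrite -tot addrC addKr; congr (_%:R); apply: eq_card => r; rewrite !inE.
by apply: two_thirds_le hmiss; [exact: repetition_third | exact: ltW].
Qed.
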